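(* One has $$\lim_{s\to\infty}p_{1,s}=\frac{\log 2}{\log(1+\sqrt2)},$$ where $s$ runs over positive integers. Equivalently, the optimal (largest) exponent $p$ for which $$G_{s+1}(t^p)\ge\bigl((1+t)\,G_s(t)\bigr)^p\qquad\text{for all }0\le t\le 1$$ converges to $\log 2/\log(1+\sqrt2)$ as $s\to\infty$.
   Context: For an integer $n\ge 0$ and $0\le t\le 1$, put $G_n(t):=1+t+\cdots+t^n$. For positive integers $r,s$, a real number $p>0$ is called admissible for $(r,s)$ if $$G_{r+s}(t^p)\ge G_r(t)^p\,G_s(t)^p\qquad\text{for all }0\le t\le 1,$$ and $p=0$ is declared admissible as well. $p_{r,s}$ denotes the largest admissible exponent for $(r,s)$ (it exists: the set of admissible exponents is a closed bounded interval $[0,p_{r,s}]$). *)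

(* Defs.v *)
From HB Require Import structures.
From mathcomp Require Import all_boot all_order all_algebra.
From mathcomp Require Import all_classical all_reals all_analysis.
Set Implicit Arguments.
Unset Strict Implicit.
Unset Printing Implicit Defensive.
Import Order.TTheory GRing.Theory Num.Theory.
Import numFieldNormedType.Exports.
Local Open Scope classical_set_scope.
Local Open Scope ring_scope.

Definition G (R : realType) (n : nat) (t : R) : R := \sum_(i < n.+1) t ^+ i.

(* For p > 0, [powR] satisfies 0 `^ p = 0, as needed at the endpoint t = 0. *)
Definition admissible (R : realType) (r s : nat) (p : R) : Prop :=
  p = 0 \/
  0 < p /\
  forall t : R, 0 <= t <= 1 ->
    G (r + s) (t `^ p) >= G r t `^ p * G s t `^ p.

(* The greatest element of A; the junk value is 0 when A has none. *)
Definition largest (R : realType) (A : set R) : R :=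
  xget 0 [set m | A m /\ forall q, A q -> q <= m].

Definition p_max (R : realType) (r s : nat) : R := largest (admissible r s).

(* Main.v *)
Require Import Defs.
From HB Require Import structures.
From mathcomp Require Import all_boot all_order all_algebra.
From mathcomp Require Import all_classical all_reals all_analysis.
From mathcomp Require Import ring lra.
Set Implicit Arguments.
Unset Strict Implicit.
Unset Printing Implicit Defensive.
Import Order.TTheory GRing.Theory Num.Theory.
Import numFieldNormedType.Exports.
Local Open Scope classical_set_scope.
Local Open Scope ring_scope.

(** Why the limit is the stated one.  Put u = (1 - t) / (1 + t), and let L be
    ln 2 / ln (1 + sqrt 2).  For fixed t < 1, letting s tend to infinity in the
    admissibility inequality for (1, s) turns it into 1 / (1 - t^p) >= u^(-p),
    that is

      t^p + u^p >= 1.                                                (E)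

    The map exchanging t and u is an involution with fixed point sqrt 2 - 1.
    There (E) reads 2 (sqrt 2 - 1)^p >= 1, that is p <= L.  This gives the
    upper bound [near_pos_admissible1_ub]: at t = sqrt 2 - 1, the inequality
    for finite s is a perturbation of (E), with u replaced by
    u / (1 - t^(s+1)).

    The substance is that, for p = L, (E) holds on all of [0, 1]
    ([powR_silver_exponent_ge1]).  With P = 1 / L, so 2^P = 1 + sqrt 2, and
    v = t^L, it becomes (1 + v^P) (1 + (1 - v)^P) <= 2, and writing
    v = (1 + z) / 2, it becomes, with b = 2^(-P),

      b ((1 + z)^P + (1 - z)^P) + b^2 (1 - z^2)^P <= 1.

    Since 1 < P < 2, both summands on the left are convex functions of z^2 (all
    the binomial coefficients of P of even index are nonnegative), and equality
    holds at z^2 = 0 and at z^2 = 1: the sum lies below its chord.  The chord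
    bound for the first summand is [powR_sum_le_chord].

    For the lower bound [near_pos_admissible1], let p < L.  Since L < 1, near
    t = 1 the sum G_s(t) is large and G_(s+1)(t^p) >= G_s(t) beats
    2^p G_s(t)^p.  Away from t = 1, (E) for L gives a gap

      t^p + u^p - 1 >= t^p - t^L = t^p (1 - t^(L-p)),

    which absorbs the term t^(p(s+2)) lost by truncating the geometric series.
    Finally the positive admissible exponents form a set that contains its
    supremum, by continuity in p, so the largest one exists as soon as both
    bounds are in force. *)

Section SilverExponent.
Variable R : realType.
Implicit Types (p q r t v x y z P : R) (n s : nat).

(** * A chord bound for (1 + z)^P + (1 - z)^P *)

Definition powR_sum r z := (1 + z) `^ r + (1 - z) `^ r.
Definition powR_diff r z := (1 + z) `^ r - (1 - z) `^ r.

Lemma is_derive_powR1D r z : -1 < z ->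
  is_derive z 1 (fun x => (1 + x) `^ r) (r * (1 + z) `^ (r - 1)).
Proof.
move=> z1; have h : 0 < 1 + z by lra.
have d2 : is_derive z 1 (fun x : R => 1 + x) 1.
  by apply: is_derive_eq; rewrite -?[_ *: _]/(_ * _); ring.
have := @is_derive1_comp R (@powR R ^~ r) (fun x => 1 + x) z _ _
  (is_derive1_powR r h) d2.
by rewrite mulr1.
Qed.

Lemma is_derive_powR1B r z : z < 1 ->
  is_derive z 1 (fun x => (1 - x) `^ r) (- (r * (1 - z) `^ (r - 1))).
Proof.
move=> z1; have h : 0 < 1 - z by lra.
have d2 : is_derive z 1 (fun x : R => 1 - x) (- 1).
  by apply: is_derive_eq; rewrite -?[_ *: _]/(_ * _); ring.
have := @is_derive1_comp R (@powR R ^~ r) (fun x => 1 - x) z _ _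
  (is_derive1_powR r h) d2.
by rewrite mulrN1.
Qed.

Lemma is_derive_powR_sum r z : -1 < z < 1 ->
  is_derive z 1 (powR_sum r) (r * powR_diff (r - 1) z).
Proof.
move=> /andP[z0 z1]; rewrite /powR_diff mulrBr.
exact: (is_deriveD (is_derive_powR1D r z0) (is_derive_powR1B r z1)).
Qed.

Lemma is_derive_powR_diff r z : -1 < z < 1 ->
  is_derive z 1 (powR_diff r) (r * powR_sum (r - 1) z).
Proof.
move=> /andP[z0 z1]; rewrite /powR_sum mulrDr -[X in _ + X]opprK.
exact: (is_deriveB (is_derive_powR1D r z0) (is_derive_powR1B r z1)).
Qed.

Lemma mean_value (f df : R -> R) (a b : R) : a < b ->
  (forall x, a <= x <= b -> is_derive x 1 f (df x)) ->
  exists2 c, a < c < b & f b - f a = df c * (b - a).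
Proof.
move=> ab fdf; have [||c] := @MVT R f df a b ab.
- by move=> x /itvP xab; apply: fdf; rewrite !xab.
- apply: derivable_within_continuous => x /itvP xab.
  by apply: (@ex_derive _ _ _ _ _ _ _ (fdf x _)); rewrite !xab.
- by rewrite in_itv /=; exists c.
Qed.

(** For r <= 0, the function x^(r-1) is nonincreasing, which makes the
    derivative r ((1 + z)^(r-1) - (1 - z)^(r-1)) nonnegative. *)
Lemma powR_sum_nondecreasing r a b : r <= 0 -> 0 <= a -> a < b -> b < 1 ->
  powR_sum r a <= powR_sum r b.
Proof.
move=> r0 a0 ab b1.
have [|c /andP[ac cb] e] :=
    mean_value (f := powR_sum r) (df := fun x => r * powR_diff (r - 1) x) ab.
  by move=> x /andP[ax xb]; apply: is_derive_powR_sum; apply/andP; split; lra.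
rewrite -subr_ge0 e; apply: mulr_ge0; last lra.
rewrite mulr_le0 // /powR_diff subr_le0.
have [n n0 ->] : exists2 n, 0 <= n & r - 1 = - n by exists (1 - r); lra.
rewrite !powRN lef_pV2 ?posrE ?powR_gt0 //; try lra.
by apply: ge0_ler_powR; rewrite ?nnegrE; lra.
Qed.

(** The derivative q ((1 + z)^(q-1) + (1 - z)^(q-1)) is nondecreasing on
    [0, 1), so [powR_diff q] is convex there; as it vanishes at 0, the slope of
    its chord from 0 increases with the other endpoint. *)
Lemma powR_diff_slope q a b : 0 <= q <= 1 -> 0 < a -> a < b -> b < 1 ->
  powR_diff q a * b <= powR_diff q b * a.
Proof.
move=> /andP[q0 q1] a0 ab b1.
have [|c /andP[c0 ca] e] :=
    mean_value (f := powR_diff q) (df := fun x => q * powR_sum (q - 1) x) a0.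
  by move=> x /andP[ax xb]; apply: is_derive_powR_diff; apply/andP; split; lra.
have [|d /andP[ad db] e'] :=
    mean_value (f := powR_diff q) (df := fun x => q * powR_sum (q - 1) x) ab.
  by move=> x /andP[ax xb]; apply: is_derive_powR_diff; apply/andP; split; lra.
have k0 : powR_diff q 0 = 0 by rewrite /powR_diff addr0 subr0 subrr.
have cd : q * powR_sum (q - 1) c <= q * powR_sum (q - 1) d.
  by apply: ler_wpM2l => //; apply: powR_sum_nondecreasing; lra.
rewrite k0 !subr0 in e.
have : q * powR_sum (q - 1) c * (a * (b - a)) <=
       q * powR_sum (q - 1) d * (a * (b - a)).
  by apply: ler_wpM2r => //; apply: mulr_ge0; lra.
nra.
Qed.

(** As a function of z^2, [powR_sum P] is convex, and the right-hand side is
    its chord between 0 and 1.  Convexity is used in the form that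
    [powR_diff (P - 1) z / z] is nondecreasing.  If the difference D of the two
    sides, which vanishes at 0 and 1, were negative at z, its derivative would
    be negative at some c < z and positive at some d > z; but D' x / x is
    nonincreasing. *)
Lemma powR_sum_le_chord P z : 1 < P < 2 -> 0 <= z <= 1 ->
  powR_sum P z <= 2 + (2 `^ P - 2) * z ^+ 2.
Proof.
move=> /andP[P1 P2] /andP[z0 z1].
pose D (x : R) := 2 + (2 `^ P - 2) * x ^+ 2 - powR_sum P x.
pose D' (x : R) := (2 `^ P - 2) * (2 * x) - P * powR_diff (P - 1) x.
have dD (x : R) : 0 <= x < 1 -> is_derive x 1 D (D' x).
  move=> /andP[x0 x1].
  have d1 : is_derive x 1 (fun y : R => 2 + (2 `^ P - 2) * y ^+ 2)
      ((2 `^ P - 2) * (2 * x)).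
    apply: is_derive_eq; rewrite add0r /GRing.scale /=; ring.
  by apply: (is_deriveB d1); apply: is_derive_powR_sum; apply/andP; split; lra.
rewrite -subr_ge0 -/(D z) leNgt; apply/negP => Dz.
have D0 : D 0 = 0.
  by rewrite /D /powR_sum expr0n /= mulr0 !addr0 subr0 powR1; ring.
have D1 : D 1 = 0.
  rewrite /D /powR_sum subrr powR0 ?gt_eqF //; last lra.
  rewrite -[1 + 1]/(2 : R); ring.
have zp : 0 < z.
  by rewrite lt_neqAle z0 andbT; apply/eqP => e; move: Dz; rewrite -e D0 ltxx.
have zl : z < 1.
  by rewrite lt_neqAle z1 andbT; apply/eqP => e; move: Dz; rewrite e D1 ltxx.
have C2 : 2 <= 2 `^ P by rewrite le1r_powR //; lra.
(* The formula for the derivative of (1 - x)^P holds for x < 1, so the second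
   use of the mean value theorem stops at a point y < 1.  As P >= 1 makes
   (1 - y)^P <= 1 - y, D is bounded below near 1 by a linear function that
   vanishes at 1. *)
have [y /andP[zy y1] Dy] : exists2 y : R, z < y < 1 & D z < D y.
  pose K := 2 * 2 `^ P + 1 - D z.
  have K0 : 0 < K by rewrite /K; lra.
  have lowD (y : R) : 0 < y < 1 -> - (2 * 2 `^ P + 1) * (1 - y) <= D y.
    move=> /andP[y0 y1].
    have h1 : (1 + y) `^ P <= 2 `^ P.
      by apply: ge0_ler_powR; rewrite ?nnegrE; lra.
    have h2 : (1 - y) `^ P <= 1 - y.
      by apply: ge1r_powR; [apply/andP; split|]; lra.
    have h3 : (2 `^ P - 2) * (1 - y ^+ 2) <= (2 `^ P - 2) * (2 * (1 - y)).
      apply: ler_wpM2l; first lra.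
      by rewrite expr2; nra.
    rewrite /D /powR_sum; lra.
  pose e := Order.min ((1 - z) / 2) (- D z / (2 * K)).
  have e0 : 0 < e by rewrite lt_min !divr_gt0 ?mulr_gt0 //; lra.
  have ez : e <= (1 - z) / 2 by rewrite ge_min lexx.
  have eK : e * (2 * K) <= - D z.
    by rewrite -ler_pdivlMr ?mulr_gt0 // ge_min lexx orbT.
  exists (1 - e); first by apply/andP; split; lra.
  have h : 0 < 1 - e < 1 by apply/andP; split; lra.
  move: (lowD _ h) eK K0 e0 Dz; rewrite /K.
  set A := 2 `^ P; set B := D z; nra.
have [|c /andP[c0 cz] e] := mean_value (f := D) (df := D') zp.
  by move=> x /andP[x0 xz]; apply: dD; apply/andP; split; lra.
have [|d /andP[zd dy] e'] := mean_value (f := D) (df := D') zy.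
  by move=> x /andP[x0 xz]; apply: dD; apply/andP; split; lra.
have D'c : D' c < 0 by nra.
have D'd : 0 < D' d by nra.
have cd : c < d by lra.
have d1 : d < 1 by lra.
have q01 : 0 <= P - 1 <= 1 by apply/andP; split; lra.
move: (powR_diff_slope q01 c0 cd d1); rewrite /D' in D'c D'd.
move: D'c D'd; set A := powR_diff _ c; set B := powR_diff _ d => h1 h2 h3.
nra.
Qed.

(** * The limiting inequality *)

(** Named after the silver ratio 1 + sqrt 2; written L in the comments. *)
Definition silver_exponent : R := ln 2 / ln (1 + Num.sqrt 2).

Lemma sqrt2_gt1 : 1 < Num.sqrt (2 : R).
Proof. by rewrite -[X in X < _]sqrtr1 ltr_sqrt ?ltr1n. Qed.

Lemma sqrt2_sqr : Num.sqrt (2 : R) ^+ 2 = 2.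
Proof. by rewrite sqr_sqrtr. Qed.

Lemma sqrt2_lt2 : Num.sqrt (2 : R) < 2.
Proof. by have := sqrt2_sqr; have := sqrt2_gt1; nra. Qed.

Lemma ln2_gt0 : 0 < ln (2 : R).
Proof. by rewrite ln_gt0 // ltr1n. Qed.

Lemma ltr_ln2_silver : ln 2 < ln (1 + Num.sqrt 2) :> R.
Proof. by have h := sqrt2_gt1; rewrite ltr_ln ?posrE; lra. Qed.

Lemma silver_exponent_gt0 : 0 < silver_exponent.
Proof.
by apply: divr_gt0; [|apply: lt_trans ltr_ln2_silver]; exact: ln2_gt0.
Qed.

Lemma silver_exponent_lt1 : silver_exponent < 1.
Proof.
by rewrite ltr_pdivrMr ?mul1r ?ltr_ln2_silver //
  (lt_trans ln2_gt0 ltr_ln2_silver).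
Qed.

Lemma silver_exponentV_lt2 : silver_exponent^-1 < 2.
Proof.
have h := sqrt2_lt2; have h1 := sqrt2_gt1.
rewrite invf_div ltr_pdivrMr ?ln2_gt0 // mulr_natl -lnXn //.
rewrite ltr_ln ?posrE //; nra.
Qed.

Lemma powR_silver_exponent : (Num.sqrt 2 - 1) `^ silver_exponent = 2^-1 :> R.
Proof.
have h := sqrt2_sqr; have h1 := sqrt2_gt1.
have h2 : 0 < ln (1 + Num.sqrt (2 : R)) := lt_trans ln2_gt0 ltr_ln2_silver.
have -> : Num.sqrt 2 - 1 = (1 + Num.sqrt 2)^-1 :> R.
  apply: (mulIf (x := 1 + Num.sqrt 2)); first by rewrite gt_eqF //; lra.
  rewrite mulVf ?gt_eqF //; nra.
rewrite /powR gt_eqF ?invr_gt0 ?lnV ?posrE; try lra.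
rewrite mulrN /silver_exponent divfK ?gt_eqF // -lnV ?posrE // lnK // posrE.
by rewrite invr_gt0.
Qed.

Lemma half_powR_silver_exponentV :
  (2^-1) `^ silver_exponent^-1 = Num.sqrt 2 - 1 :> R.
Proof.
have h1 := sqrt2_gt1.
rewrite -powR_silver_exponent -powRrM mulfV ?powRr1 ?gt_eqF
  ?silver_exponent_gt0 //; lra.
Qed.

(** Expanding the product with b = 2^(-P), the chord bound controls the sum of
    the two powers, and (1 - z^2)^P <= 1 - z^2 their product.  The resulting
    upper bound is affine in z^2; the hypothesis on b, that is b^2 = 1 - 2 b,
    makes it equal to 2 at both ends, hence constant. *)
Lemma prod_1DpowR_le2_half P z :
  1 < P < 2 -> (1 + 2^-1 `^ P) ^+ 2 = 2 -> 0 <= z <= 1 ->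
  (1 + ((1 + z) / 2) `^ P) * (1 + ((1 - z) / 2) `^ P) <= 2.
Proof.
move=> P12 b2 z01; have := powR_sum_le_chord P12 z01.
move: (P12) (z01) => /andP[P1 P2] /andP[z0 z1].
rewrite /powR_sum !(@powRM _ _ 2^-1) ?invr_ge0 //; try lra.
set b := 2^-1 `^ P in b2 *; set x := (1 + z) `^ P; set y := (1 - z) `^ P.
have b0 : 0 <= b by exact: powR_ge0.
have bV : b * 2 `^ P = 1.
  by rewrite /b -powRM ?mulVf ?powR1 ?invr_ge0 // pnatr_eq0.
have xy : x * y <= 1 - z ^+ 2.
  rewrite /x /y -powRM; try lra.
  have -> : (1 + z) * (1 - z) = 1 - z ^+ 2 by ring.
  have [->|z1'] := eqVneq z 1.
    by rewrite expr1n subrr powR0 // gt_eqF //; lra.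
  have zl : z < 1 by rewrite lt_neqAle z1'.
  by apply: ge1r_powR; [apply/andP; split; nra|lra].
move=> hxy.
have h1 : b * (x + y) <= b * (2 + (2 `^ P - 2) * z ^+ 2) by apply: ler_wpM2l.
have h2 : b ^+ 2 * (x * y) <= b ^+ 2 * (1 - z ^+ 2).
  by apply: ler_wpM2l => //; exact: sqr_ge0.
have e1 : b * (2 + (2 `^ P - 2) * z ^+ 2) = 2 * b + (1 - 2 * b) * z ^+ 2.
  have -> : b * (2 + (2 `^ P - 2) * z ^+ 2) =
      2 * b + (b * 2 `^ P - 2 * b) * z ^+ 2 by ring.
  by rewrite bV.
rewrite e1 in h1.
have e2 : b ^+ 2 = 1 - 2 * b by move: b2; rewrite sqrrD expr1n; lra.
rewrite e2 in h2.
have -> : (1 + x * b) * (1 + y * b) =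
    1 + b * (x + y) + b ^+ 2 * (x * y) by ring.
rewrite e2; lra.
Qed.

Lemma prod_1DpowR_le2 P v :
  1 < P < 2 -> (1 + 2^-1 `^ P) ^+ 2 = 2 -> 0 <= v <= 1 ->
  (1 + v `^ P) * (1 + (1 - v) `^ P) <= 2.
Proof.
move=> P12 b2; wlog v2 : v / 2^-1 <= v => [hw|] v01.
  have [/hw|v2] := leP 2^-1 v; first exact.
  have e : 1 - (1 - v) = v by ring.
  by have := hw (1 - v); rewrite e mulrC; apply; lra.
have := @prod_1DpowR_le2_half P (2 * v - 1) P12 b2.
have -> : (1 + (2 * v - 1)) / 2 = v by field.
have -> : (1 - (2 * v - 1)) / 2 = 1 - v by field.
apply; lra.
Qed.

(** Apply the preceding inequality to v = t^L and P = 1 / L.  It bounds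
    (1 - v)^P by 2 / (1 + t) - 1 = (1 - t) / (1 + t); then take L-th powers. *)
Lemma powR_silver_exponent_ge1 t : 0 <= t <= 1 ->
  1 <= t `^ silver_exponent + ((1 - t) / (1 + t)) `^ silver_exponent.
Proof.
move=> t01; have L0 := silver_exponent_gt0.
have LN0 : silver_exponent != 0 by rewrite gt_eqF.
move: (t01) => /andP[t0 t1].
have v0 : 0 <= t `^ silver_exponent := powR_ge0 _ _.
have v1 : t `^ silver_exponent <= 1.
  have <- : 1 `^ silver_exponent = 1 by rewrite powR1.
  by apply: ge0_ler_powR; rewrite ?nnegrE //; lra.
have P12 : 1 < silver_exponent^-1 < 2.
  by rewrite silver_exponentV_lt2 andbT invf_gt1 ?silver_exponent_lt1.
have b2 : (1 + 2^-1 `^ silver_exponent^-1) ^+ 2 = 2 :> R.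
  by rewrite half_powR_silver_exponentV subrKC sqrt2_sqr.
have v01 : 0 <= t `^ silver_exponent <= 1 by rewrite v0.
have := prod_1DpowR_le2 P12 b2 v01.
rewrite -powRrM mulfV // powRr1 // mulrC -ler_pdivlMr; last lra.
set w := (1 - _) `^ _ => hw.
have w0 : 0 <= w by exact: powR_ge0.
have hu : w <= (1 - t) / (1 + t).
  have -> : (1 - t) / (1 + t) = 2 / (1 + t) - 1 by field; lra.
  lra.
have : w `^ silver_exponent <= ((1 - t) / (1 + t)) `^ silver_exponent.
  by apply: ge0_ler_powR; rewrite ?nnegrE //; lra.
rewrite /w -powRrM mulVf // powRr1; lra.
Qed.

(** * Bounds on the admissible exponents for large s *)

Lemma geom_sumE n t : (1 - t) * G n t = 1 - t ^+ n.+1.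
Proof. by rewrite -[RHS]opprB subrX1 -mulNr opprB. Qed.

Lemma geom_sum_at0 n : G n (0 : R) = 1.
Proof. by have := geom_sumE n 0; rewrite subr0 mul1r expr0n /= subr0. Qed.

Lemma geom_sum1 t : G 1 t = 1 + t.
Proof. by rewrite /G !big_ord_recl big_ord0 expr0 expr1 addr0. Qed.

Lemma geom_sum_ge1 n t : 0 <= t -> 1 <= G n t.
Proof.
move=> t0; rewrite /G big_ord_recl expr0 lerDl.
by apply: sumr_ge0 => i _; exact: exprn_ge0.
Qed.

Lemma ler_geom_sum n x y : 0 <= x -> x <= y -> G n x <= G n y.
Proof.
move=> x0 xy; apply: ler_sum => i _.
by rewrite lerXn2r ?nnegrE // (le_trans x0).
Qed.

Lemma ler_geom_sumS n x : 0 <= x -> G n x <= G n.+1 x.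
Proof. by move=> x0; rewrite [leRHS]/G big_ord_recr lerDl exprn_ge0. Qed.

Lemma near_expr_le x e : 0 <= x < 1 -> 0 < e ->
  \forall s \near \oo, x ^+ s.+1 <= e.
Proof.
move=> /andP[x0 x1] e0.
have xx : `|x| < 1 by rewrite ger0_norm.
have /cvgrPdist_le/(_ _ e0) := cvg_expr xx.
apply: filterS => s; rewrite sub0r normrN ger0_norm ?exprn_ge0 // => h.
by rewrite exprS (le_trans _ h) // ler_piMl ?exprn_ge0 // ltW.
Qed.

(** The set of the second limit of the theorem; by [admissible1E] it differs
    from the admissible exponents for (1, s) by the exponent 0 only. *)
Definition pos_admissible1 s : set R :=
  [set p : R | 0 < p /\ forall t : R, 0 <= t <= 1 ->
    G s.+1 (t `^ p) >= ((1 + t) * G s t) `^ p].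

(** The threshold on [G s t] says that [G s t `^ (1 - p)] is at least 2^p,
    which dominates (1 + t)^p. *)
Lemma admissible1_large_sum s p t :
  0 < p < 1 -> 0 < t <= 1 -> 2 `^ (p / (1 - p)) <= G s t ->
  ((1 + t) * G s t) `^ p <= G s.+1 (t `^ p).
Proof.
move=> /andP[p0 p1] /andP[t0 t1] hG.
have G1 := geom_sum_ge1 s (ltW t0).
have h1 : (1 + t) `^ p <= G s t `^ (1 - p).
  apply: (@le_trans _ _ (2 `^ p)).
    by apply: ge0_ler_powR; rewrite ?nnegrE //; lra.
  have -> : 2 `^ p = (2 `^ (p / (1 - p))) `^ (1 - p).
    by rewrite -powRrM divfK // gt_eqF //; lra.
  by apply: ge0_ler_powR; rewrite ?nnegrE ?powR_ge0 //; lra.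
rewrite powRM; [|lra|lra].
apply: (@le_trans _ _ (G s t)).
  rewrite -[leRHS](@powRr1 R); last lra.
  have -> : G s t `^ 1 = G s t `^ (1 - p) * G s t `^ p.
    by rewrite -powRD ?subrK // oner_eq0.
  by apply: ler_wpM2r => //; exact: powR_ge0.
apply: (le_trans _ (ler_geom_sumS _ (powR_ge0 _ _))).
by apply: ler_geom_sum; [lra|apply: ger1_powR; lra].
Qed.

(** With q = t^p and u = (1 - t) / (1 + t), the left-hand side is at most
    u^(-p) and the right-hand side is (1 - q^(s+2)) / (1 - q), so it suffices
    that (1 - q^(s+2)) u^p >= 1 - q.  As u^p >= u^L >= 1 - t^L, there is room
    for an error term of size q - t^L = q (1 - t^(L-p)). *)
Lemma admissible1_away_from_1 s p t : 0 < p -> 0 < t < 1 ->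
  (t `^ p) ^+ s.+1 <= 1 - t `^ (silver_exponent - p) ->
  ((1 + t) * G s t) `^ p <= G s.+1 (t `^ p).
Proof.
move=> p0 /andP[t0 t1] hs; set L := silver_exponent in hs.
set u := (1 - t) / (1 + t); set q := t `^ p in hs *.
have u0 : 0 < u by apply: divr_gt0; lra.
have u1 : u <= 1 by rewrite ler_pdivrMr; lra.
have q0 : 0 < q by exact: powR_gt0.
have q1 : q < 1.
  have <- : 1 `^ p = 1 by rewrite powR1.
  by apply: gt0_ltr_powR; rewrite ?nnegrE //; lra.
have pL : p <= L.
  rewrite leNgt; apply/negP => Lp.
  have h : 1 <= t `^ (L - p).
    rewrite -(powRr0 t); apply: ger_powR; lra.
  have : 0 < q ^+ s.+1 by exact: exprn_gt0.
  lra.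
have U0 : 0 < u `^ p by exact: powR_gt0.
have U1 : u `^ p <= 1.
  have <- : 1 `^ p = 1 by rewrite powR1.
  by apply: ge0_ler_powR; rewrite ?nnegrE //; lra.
have hU : 1 - q * t `^ (L - p) <= u `^ p.
  have t01 : 0 <= t <= 1 by lra.
  have := powR_silver_exponent_ge1 t01; rewrite -/L -/u.
  have -> : t `^ L = q * t `^ (L - p).
    by rewrite /q -powRD ?subrKC // (gt_eqF t0) implybT.
  have : u `^ L <= u `^ p by apply: ger_powR; lra.
  lra.
have hA : ((1 + t) * G s t) `^ p <= (u `^ p)^-1.
  rewrite -powRN -mulN1r powRrM powR_inv1; last lra.
  apply: ge0_ler_powR; rewrite ?nnegrE ?invr_ge0; try lra.
    by apply: mulr_ge0; [lra|rewrite (le_trans _ (geom_sum_ge1 _ _)) //; lra].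
  rewrite invf_div ler_pdivlMr; last lra.
  rewrite -mulrA [G s t * _]mulrC geom_sumE.
  have : 0 <= t ^+ s.+1 by apply: exprn_ge0; lra.
  nra.
apply: (le_trans hA).
have e := geom_sumE s.+1 q.
have Q0 : 0 <= q ^+ s.+1 by apply: exprn_ge0; lra.
rewrite exprS in e.
have : q * q ^+ s.+1 <= q * (1 - t `^ (L - p)) by apply: ler_wpM2l => //; lra.
have : q * q ^+ s.+1 * u `^ p <= q * q ^+ s.+1.
  by apply: ler_piMr => //; apply: mulr_ge0; lra.
move=> h2 h1.
rewrite -[leLHS]mul1r ler_pdivrMr // -(ler_pM2l (x := 1 - q)); last lra.
rewrite mulrA e mulr1; lra.
Qed.

(** The interval [0, 1] is cut at a point t0 < 1 that depends on p only, so
    close to 1 that G_s(t0) eventually passes the threshold of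
    [admissible1_large_sum].  On [0, t0] the hypothesis of
    [admissible1_away_from_1] is implied by its case t = t0. *)
Lemma near_pos_admissible1 p : 0 < p < silver_exponent ->
  \forall s \near \oo, pos_admissible1 s p.
Proof.
move=> /andP[p0 pL]; have L1 := silver_exponent_lt1.
set K := 2 `^ (p / (1 - p)) : R.
have K1 : 1 <= K.
  have <- : 2 `^ 0 = 1 :> R by rewrite powRr0.
  by apply: ler_powR; [lra|apply: divr_ge0; lra].
(* The full geometric series at t0 sums to 2 K, twice the threshold. *)
set t0 := 1 - (2 * K)^-1.
have Ki : (2 * K)^-1 * K = 2^-1 by field; lra.
have Ki0 : 0 < (2 * K)^-1 by rewrite invr_gt0; lra.
have t01 : 0 < t0 < 1 by rewrite /t0; nra.
have q01 : 0 <= t0 `^ p < 1.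
  rewrite powR_ge0 /=; have <- : 1 `^ p = 1 by rewrite powR1.
  by apply: gt0_ltr_powR; rewrite ?nnegrE //; lra.
have d0 : 0 < 1 - t0 `^ (silver_exponent - p).
  have : t0 `^ (silver_exponent - p) < 1 `^ (silver_exponent - p).
    by apply: gt0_ltr_powR; rewrite ?nnegrE //; lra.
  by rewrite powR1; lra.
have half0 : 0 < 2^-1 :> R by lra.
have t01' : 0 <= t0 < 1 by lra.
near=> s.
have hs1 : t0 ^+ s.+1 <= 2^-1 by near: s; exact: near_expr_le.
have hs2 : (t0 `^ p) ^+ s.+1 <= 1 - t0 `^ (silver_exponent - p).
  by near: s; exact: near_expr_le.
split=> // t /andP[t_ge0 t_le1].
have [->|tN0] := eqVneq t 0.
  by rewrite powR0 ?gt_eqF // !geom_sum_at0 addr0 mulr1 powR1.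
have t_gt0 : 0 < t by rewrite lt_neqAle eq_sym tN0.
have [tt0|tt0] := leP t0 t.
  apply: admissible1_large_sum; [lra|lra|].
  apply: (le_trans _ (ler_geom_sum s _ tt0)); last lra.
  rewrite -(ler_pM2l Ki0) Ki.
  have -> : (2 * K)^-1 = 1 - t0 by rewrite /t0; ring.
  rewrite geom_sumE; lra.
apply: admissible1_away_from_1 => //; first lra.
have h1 : t `^ (silver_exponent - p) <= t0 `^ (silver_exponent - p).
  by apply: ge0_ler_powR; rewrite ?nnegrE //; lra.
have h2 : (t `^ p) ^+ s.+1 <= (t0 `^ p) ^+ s.+1.
  rewrite lerXn2r ?nnegrE ?powR_ge0 //.
  by apply: ge0_ler_powR; rewrite ?nnegrE //; lra.
lra.
Unshelve. all: by end_near. Qed.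

(** Test at the fixed point a = sqrt 2 - 1 of t |-> (1 - t) / (1 + t), where
    (1 + a) G_s(a) = (1 - a^(s+1)) / a.  An admissible p satisfies
    a^p + x^p >= 1 with x = a / (1 - a^(s+1)).  For p > p1 = L + e the left-hand
    side is at most a^p1 + x^p1, which tends to 2 a^p1 < 2 a^L = 1. *)
Lemma near_pos_admissible1_ub e : 0 < e ->
  \forall s \near \oo, forall p,
    pos_admissible1 s p -> p <= silver_exponent + e.
Proof.
move=> e0; set p1 := silver_exponent + e.
have p10 : 0 < p1 by have := silver_exponent_gt0; rewrite /p1; lra.
have r1 := sqrt2_gt1; have r2 := sqrt2_lt2; have rr := sqrt2_sqr.
set a := Num.sqrt 2 - 1 : R.
have a0 : 0 < a by rewrite /a; lra.
have a1 : a < 1 by rewrite /a; lra.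
have ap : a `^ p1 < 2^-1.
  rewrite -powR_silver_exponent -/a /p1 powRD; last first.
    by rewrite (gt_eqF a0) implybT.
  rewrite -[ltRHS]mulr1 ltr_pM2l ?powR_gt0 //.
  have <- : 1 `^ e = 1 by rewrite powR1.
  by apply: gt0_ltr_powR; rewrite ?nnegrE //; lra.
have ap0 : 0 < a `^ p1 by exact: powR_gt0.
(* The value of x for which a^p1 + x^p1 = 1: it suffices to make x < y. *)
set y := (1 - a `^ p1) `^ p1^-1.
have yp : y `^ p1 = 1 - a `^ p1.
  by rewrite /y -powRrM mulVf ?gt_eqF // powRr1 //; lra.
have y0 : 0 < y by apply: powR_gt0; lra.
have ay : a < y.
  rewrite ltNge; apply/negP => ya.
  have : y `^ p1 <= a `^ p1 by apply: ge0_ler_powR; rewrite ?nnegrE //; lra.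
  lra.
have y1 : y < 1.
  rewrite ltNge; apply/negP => ya.
  have : 1 `^ p1 <= y `^ p1 by apply: ge0_ler_powR; rewrite ?nnegrE //; lra.
  rewrite powR1; lra.
set d := (1 - a / y) / 2.
have ayy : a / y < 1 by rewrite ltr_pdivrMr // mul1r.
have ayy0 : 0 < a / y by exact: divr_gt0.
have d0 : 0 < d by rewrite /d; lra.
have a01 : 0 <= a < 1 by lra.
near=> s => p [p0 hp].
have hs : a ^+ s.+1 <= d by near: s; exact: near_expr_le.
have as0 : 0 < a ^+ s.+1 by exact: exprn_gt0.
rewrite leNgt; apply/negP => p1p.
set x := a / (1 - a ^+ s.+1).
have x0 : 0 < x by apply: divr_gt0; rewrite /d in hs; lra.
have xy : x < y.
  rewrite ltr_pdivrMr; last by rewrite /d in hs; lra.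
  have : a / y * y < (1 - a ^+ s.+1) * y by rewrite ltr_pM2r // /d in hs *; lra.
  by rewrite divfK ?gt_eqF // mulrC.
have ap' : a `^ p <= a `^ p1 by apply: ger_powR; lra.
have xp' : x `^ p < 1 - a `^ p1.
  rewrite -yp; apply: (@le_lt_trans _ _ (x `^ p1)).
    by apply: ger_powR; lra.
  by apply: gt0_ltr_powR; rewrite ?nnegrE //; lra.
have a01' : 0 <= a <= 1 by lra.
have := hp a a01'.
have -> : (1 + a) * G s a = x^-1.
  apply: (mulfI (x := 1 - a)); first by rewrite gt_eqF //; lra.
  rewrite mulrCA geom_sumE /x invf_div mulrCA [RHS]mulrC; congr (_ * _).
  apply: (mulIf (x := a)); first by rewrite gt_eqF.
  rewrite divfK ?gt_eqF // /a; nra.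
rewrite -(powR_inv1 (ltW x0)) -powRrM mulN1r powRN.
have xp0 : 0 < x `^ p by exact: powR_gt0.
rewrite -[leLHS]mul1r ler_pdivrMr //.
have := geom_sumE s.+1 (a `^ p); set g := G _ _.
have : 0 <= (a `^ p) ^+ s.+2 by apply: exprn_ge0; exact: powR_ge0.
have : 1 <= g by apply: geom_sum_ge1; exact: powR_ge0.
nra.
Unshelve. all: by end_near. Qed.

(** * Existence of the largest exponent *)

Lemma largest_max (A : set R) (m : R) : A m -> ubound A m -> largest A = m.
Proof.
move=> Am mub; apply: xget_unique => [|q [Aq qub]]; first by split.
by apply/eqP; rewrite eq_le mub //= qub.
Qed.

Lemma continuous_powRr x : 0 < x -> continuous (@powR R x).
Proof.
move=> x0 p.
have -> : powR x = (fun q => expR (q * ln x)).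
  by apply/funext => q; rewrite /powR gt_eqF.
apply: continuous_comp; last exact: continuous_expR.
by apply: cvgM; [exact: cvg_id|exact: cvg_cst].
Qed.

Lemma continuous_geom_sum n : continuous (@G R n).
Proof.
have -> : @G R n = horner (\poly_(i < n.+1) (1 : R)).
  apply: funext => x; rewrite horner_poly.
  by apply: eq_bigr => i _; rewrite mul1r.
exact: continuous_horner.
Qed.

(** For fixed t > 0, both sides of the inequality are continuous in p, so it
    passes to the supremum; at t = 0 it always holds. *)
Lemma pos_admissible1_max s : pos_admissible1 s !=set0 ->
  has_ubound (pos_admissible1 s) ->
  exists2 m, pos_admissible1 s m & ubound (pos_admissible1 s) m.
Proof.
move=> A0 Aub; have supub := ub_le_sup Aub.
exists (sup (pos_admissible1 s)) => //.
have m0 : 0 < sup (pos_admissible1 s).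
  by have [p Ap] := A0; apply: lt_le_trans (supub _ Ap); case: Ap.
split=> // t t01; have /andP[t0 t1] := t01.
have [->|tN0] := eqVneq t 0.
  by rewrite powR0 ?gt_eqF // !geom_sum_at0 addr0 mulr1 powR1.
have tp : 0 < t by rewrite lt_neqAle eq_sym tN0.
pose f p := G s.+1 (t `^ p) - ((1 + t) * G s t) `^ p.
have fc : continuous f.
  move=> p; apply: cvgB.
    apply: (continuous_comp (f := powR t)); first exact: continuous_powRr.
    exact: continuous_geom_sum.
  apply: continuous_powRr; apply: mulr_gt0; first by lra.
  by rewrite (lt_le_trans _ (geom_sum_ge1 _ t0)).
have fcl : closed (f @^-1` [set y | 0 <= y]).
  by apply: closed_comp => [p _|]; [exact: fc|exact: closed_ge].
rewrite -subr_ge0; apply: (fcl).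
apply: closure_subset (closure_sup A0 Aub) => p [_ /(_ t t01)].
by rewrite /= /f subr_ge0.
Qed.

Lemma admissible1E s p : admissible 1 s p <-> p = 0 \/ pos_admissible1 s p.
Proof.
rewrite /admissible /pos_admissible1 /= add1n.
have h t : 0 <= t <= 1 -> ((1 + t) * G s t) `^ p = G 1 t `^ p * G s t `^ p.
  move=> /andP[t0 t1]; rewrite geom_sum1 powRM //; first by lra.
  by rewrite (le_trans _ (geom_sum_ge1 _ t0)).
by split=> -[->|[p0 hp]]; [left|right|left|right] => //; split=> // t t01;
  have := hp t t01; rewrite h.
Qed.

Lemma near_p_max1 e : 0 < e -> \forall s \near \oo,
  p_max R 1 s = largest (pos_admissible1 s) /\
  `|silver_exponent - largest (pos_admissible1 s)| <= e.
Proof.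
move=> e0; have L0 := silver_exponent_gt0.
pose p := Order.max (silver_exponent - e) (silver_exponent / 2).
have pe : silver_exponent - e <= p by rewrite le_max lexx.
have p01 : 0 < p < silver_exponent.
  rewrite lt_max gt_max.
  by apply/andP; split; [apply/orP; right|apply/andP; split]; lra.
near=> s.
have As : pos_admissible1 s p by near: s; exact: near_pos_admissible1.
have ubs : forall q, pos_admissible1 s q -> q <= silver_exponent + e.
  by near: s; exact: near_pos_admissible1_ub.
have [m Am mub] : exists2 m, pos_admissible1 s m & ubound (pos_admissible1 s) m.
  apply: pos_admissible1_max; first by exists p.
  by exists (silver_exponent + e) => q /ubs.
rewrite (largest_max Am mub); split.
  apply: largest_max; first by apply/admissible1E; right.
  by move=> q /admissible1E[->|/mub//]; rewrite ltW //; case: Am.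
have := mub _ As; have := ubs _ Am; rewrite ler_norml; lra.
Unshelve. all: by end_near. Qed.

End SilverExponent.

Theorem proposition1p4 (R : realType) :
  (p_max R 1 s @[s --> \oo] --> ln 2 / ln (1 + Num.sqrt 2)) /\
  (largest [set p : R | 0 < p /\ forall t : R, 0 <= t <= 1 ->
       G s.+1 (t `^ p) >= ((1 + t) * G s t) `^ p] @[s --> \oo]
     --> ln 2 / ln (1 + Num.sqrt 2)).
Proof.
split; apply/cvgrPdist_le => e e0; have := near_p_max1 e0;
  by apply: filterS => s [pE]; rewrite ?pE.
Qed.
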